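(* Let $R$ be a ring with proper involution $*$, let $m\ge 1$ be an integer and let $a\in R$. Then $a\in R^{\overline{W}_m}$ if and only if both of the following hold: (1) $a\in R^D$; (2) there exists $x\in R$ such that $$xR=a^DR,\quad [(a^m)^*a^{m+1}x]^*=(a^m)^*a^{m+1}x,\quad a^n=axa^{n}\ \text{for some } n\in\mathbb{N}.$$ In this case, $a^{\overline{W}_m}=x$.
   Context: Rings are associative with identity and $\mathbb{N}$ is the set of positive integers. An involution $*$ on $R$ satisfies $(x+y)^*=x^*+y^*$, $(xy)^*=y^*x^*$, $(x^* )^*=x$; it is proper if $x^*x=0$ implies $x=0$. An element $a\in R$ has an $m$-weak group inverse if there exist $x\in R$ and $k\in\mathbb{N}$ with $ax^2=x$, $xa^{k+1}=a^k$ and $(a^k)^*a^{m+1}x=(a^k)^*a^m$; such an $x$ is unique if it exists and is denoted $a^{\overline{W}_m}$. $R^{\overline{W}_m}$ is the set of elements of $R$ having an $m$-weak group inverse. $R^{D}$ is the set of Drazin invertible elements: $a\in R^D$ if there are $x\in R$, $k\in\mathbb{N}$ with $ax^2=x$, $ax=xa$, $a^k=xa^{k+1}$; this unique $x$ is denoted $a^D$. *)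

(* Defs.v *)
From mathcomp Require Import all_boot all_algebra.
From mathcomp Require Import boolp classical_sets.

Set Implicit Arguments.
Unset Strict Implicit.
Unset Printing Implicit Defensive.

Import GRing.Theory.
Local Open Scope ring_scope.

(* Rings are [pzRingType]s: the zero ring is allowed. *)

Record involution (R : pzRingType) (star : R -> R) : Prop := Involution {
  involutionD : forall x y, star (x + y) = star x + star y;
  involutionM : forall x y, star (x * y) = star y * star x;
  involutionK : forall x, star (star x) = x }.

Definition proper_involution (R : pzRingType) (star : R -> R) : Prop :=
  involution star /\ (forall x, star x * x = 0 -> x = 0).

Definition right_principal (R : pzRingType) (x : R) : set R :=
  range (fun r : R => x * r).

Definition is_drazin_inverse (R : pzRingType) (a x : R) : Prop :=
  exists k : nat,
    [/\ (0 < k)%N, a * x ^+ 2 = x, a * x = x * a & a ^+ k = x * a ^+ k.+1].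

Definition drazin_invertible (R : pzRingType) (a : R) : Prop :=
  exists x : R, is_drazin_inverse a x.

(* Total function; the value 0 is junk when [a] is not Drazin invertible. *)
Definition drazin_inverse (R : pzRingType) (a : R) : R :=
  xget 0 [set x | is_drazin_inverse a x].

Definition is_weak_group_inverse (R : pzRingType) (star : R -> R) (m : nat)
    (a x : R) : Prop :=
  exists k : nat,
    [/\ (0 < k)%N, a * x ^+ 2 = x, x * a ^+ k.+1 = a ^+ k
      & star (a ^+ k) * a ^+ m.+1 * x = star (a ^+ k) * a ^+ m].

Definition weak_group_invertible (R : pzRingType) (star : R -> R) (m : nat)
    (a : R) : Prop :=
  exists x : R, is_weak_group_inverse star m a x.

(* Total function; the value 0 is junk when [a] has no m-weak group inverse.
   The m-weak group inverse is unique when [star] is a proper involution. *)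
Definition weak_group_inverse (R : pzRingType) (star : R -> R) (m : nat)
    (a : R) : R :=
  xget 0 [set x | is_weak_group_inverse star m a x].

(* Main.v *)
(* If a x^2 = x then x = a^j x^(j+1) for every j, so x lies in every a^j R; this
   makes x R and a^D R coincide with a^j R for large j.  Put y = a^(m+1) x.
   Since y lies in a^j R, the equation of the m-weak group inverse gives
   y^* y = y^* a^m, whose right-hand side is therefore Hermitian; this is the
   symmetry of (a^m)^* a^(m+1) x.  Conversely, symmetry gives back
   y^* y = y^* a^m because y a x = y, and multiplying by (a^k)^* on the left
   turns (y a^k)^* into (a^(m+k))^*.  For uniqueness, the difference u of two
   inverses satisfies (a^(m+1) u)^* a^(m+1) u = 0; properness kills a^(m+1) u,
   and x^(m+1) a^(m+1) u = u. *)

Require Import Defs.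
From mathcomp Require Import all_boot all_algebra.
From mathcomp Require Import boolp classical_sets.

Set Implicit Arguments.
Unset Strict Implicit.
Unset Printing Implicit Defensive.

Import GRing.Theory.
Local Open Scope ring_scope.

Section OuterInverse.
Variables (R : pzRingType) (a x : R).

Lemma expr_mul_exprS (axx : a * x ^+ 2 = x) (j : nat) :
  a ^+ j * x ^+ j.+1 = x.
Proof.
elim: j => [|j IHj]; first by rewrite expr0 mul1r expr1.
rewrite exprSr (exprD x 2 j) mulrA -(mulrA _ a) axx -mulrA -exprS.
exact: IHj.
Qed.

Lemma mul_exprS_le (k j : nat) (kj : (k <= j)%N)
    (xak : x * a ^+ k.+1 = a ^+ k) : x * a ^+ j.+1 = a ^+ j.
Proof. by rewrite -(subnKC kj) -addSn !exprD mulrA xak. Qed.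

Lemma expr_mul_cancel (k : nat) (xak : x * a ^+ k.+1 = a ^+ k) (j : nat) :
  x ^+ j * a ^+ (j + k) = a ^+ k.
Proof.
elim: j => [|j IHj]; first by rewrite expr0 mul1r.
by rewrite exprSr -mulrA addSn (mul_exprS_le (leq_addl j k) xak).
Qed.

(** This produces the Drazin inverse from the m-weak group inverse: both products of the candidate
    with [a] collapse to [x ^+ k * a ^+ k]. *)
Lemma expr_drazin (axx : a * x ^+ 2 = x) (k : nat)
    (xak : x * a ^+ k.+1 = a ^+ k) : (0 < k)%N ->
  is_drazin_inverse a (x ^+ k.+1 * a ^+ k).
Proof.
move=> k_gt0.
have ad : a * (x ^+ k.+1 * a ^+ k) = x ^+ k * a ^+ k.
  rewrite mulrA; congr (_ * _).
  case: k k_gt0 {xak} => // k _.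
  by rewrite (exprD x 2 k) mulrA axx -exprS.
have da : x ^+ k.+1 * a ^+ k * a = x ^+ k * a ^+ k.
  by rewrite -mulrA -exprSr exprSr -mulrA xak.
(* Positivity of [k] lets one factor [a] be split off; then a^(k-1) x^k = x. *)
have axk : a ^+ k * x ^+ k = a * x.
  case: k k_gt0 {xak ad da} => // k _.
  by rewrite exprS -mulrA (expr_mul_exprS axx).
have axak : a * x * a ^+ k = a ^+ k.
  by rewrite -{1}xak !mulrA -(mulrA a x x) -expr2 axx xak.
exists k; split=> //; last 2 first.
- by rewrite ad da.
- by rewrite -mulrA -exprD (addnC k) expr_mul_cancel.
(* For the candidate d: a d^2 = d a d = x^(k+1) a^k x^k a^k = x^(k+1) (a x a^k) = d. *)
rewrite expr2 mulrA ad -da -mulrA ad mulrA.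
by rewrite -(mulrA _ _ (x ^+ k)) axk -!mulrA (mulrA a) axak.
Qed.

End OuterInverse.

Lemma drazin_inverseP (R : pzRingType) (a : R) :
  drazin_invertible a -> is_drazin_inverse a (drazin_inverse a).
Proof. by move=> [d dP]; apply: (xgetPex 0); exists d. Qed.

Lemma right_principal_subset (R : pzRingType) (x y r : R) :
  x = y * r -> (right_principal x `<=` right_principal y)%classic.
Proof. by move=> -> _ [s _ <-]; exists (r * s); rewrite ?mulrA. Qed.

(** Indeed x = a^l x^(l+1) = y a^(l+1) x^(l+1), and symmetrically. The Drazin inverse satisfies the
    same two equations, so it can serve as [y]. *)
Lemma right_principal_eq_outer (R : pzRingType) (a x y : R) (k l : nat) :
    a * x ^+ 2 = x -> x * a ^+ k.+1 = a ^+ k ->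
    a * y ^+ 2 = y -> y * a ^+ l.+1 = a ^+ l ->
  right_principal x = right_principal y.
Proof.
move=> axx xak ayy yal; apply/seteqP; split.
- apply: (@right_principal_subset _ _ _ (a ^+ l.+1 * x ^+ l.+1)).
  by rewrite mulrA yal expr_mul_exprS.
- apply: (@right_principal_subset _ _ _ (a ^+ k.+1 * y ^+ k.+1)).
  by rewrite mulrA xak expr_mul_exprS.
Qed.

Section WeakGroupInverse.
Variables (R : pzRingType) (star : R -> R) (m : nat) (a : R).

(** Since (a^j)^* = (a^(j-k))^* (a^k)^*, two inverses with different exponents can be compared at a
    common one. *)
Lemma star_expr_mul_le (starP : involution star) (k j : nat) (u v : R) :
    (k <= j)%N -> star (a ^+ k) * u = star (a ^+ k) * v ->
  star (a ^+ j) * u = star (a ^+ j) * v.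
Proof.
by move=> kj e; rewrite -(subnKC kj) exprD (involutionM starP) -!mulrA e.
Qed.

Lemma weak_group_inverse_unique (star_proper : proper_involution star)
    (x z : R) :
  is_weak_group_inverse star m a x -> is_weak_group_inverse star m a z ->
  x = z.
Proof.
have [starP proper] := star_proper.
move=> [k [_ axx xak xs]] [l [_ azz zal zs]].
set j := (k + l)%N.
have xaj : x * a ^+ j.+1 = a ^+ j := mul_exprS_le (leq_addr l k) xak.
have {}xs : star (a ^+ j) * (a ^+ m.+1 * x) = star (a ^+ j) * a ^+ m.
  by apply: (star_expr_mul_le starP (leq_addr l k)); rewrite mulrA.
have {}zs : star (a ^+ j) * (a ^+ m.+1 * z) = star (a ^+ j) * a ^+ m.
  by apply: (star_expr_mul_le starP (leq_addl k l)); rewrite mulrA.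
pose s := x ^+ j.+1 - z ^+ j.+1.
have xzE : x - z = a ^+ j * s by rewrite mulrBr !expr_mul_exprS.
have y0 : a ^+ m.+1 * (x - z) = 0.
  apply: proper.
  rewrite {1}xzE (mulrA _ (a ^+ j)) -exprD addnC exprD -(mulrA (a ^+ j)).
  by rewrite (involutionM starP) -mulrA !mulrBr xs zs subrr.
apply/eqP; rewrite -subr_eq0 xzE -(expr_mul_cancel xaj m.+1) exprD.
by rewrite -!mulrA -xzE y0 mulr0.
Qed.

Lemma weak_group_inverse_symmetric (starP : involution star) (x : R) :
    is_weak_group_inverse star m a x ->
  star (star (a ^+ m) * a ^+ m.+1 * x) = star (a ^+ m) * a ^+ m.+1 * x.
Proof.
move=> [k [_ axx xak xs]].
pose y := a ^+ m.+1 * x.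
have yE : y = a ^+ k * (a ^+ m.+1 * x ^+ k.+1).
  by rewrite mulrA -exprD addnC exprD -mulrA expr_mul_exprS.
have yy : star y * y = star y * a ^+ m.
  by rewrite {1 3}yE (involutionM starP) -!mulrA -xs /y !mulrA.
have yyH : star (star y * y) = star y * y.
  by rewrite (involutionM starP) (involutionK starP).
have ym : star (a ^+ m) * y = star y * y.
  by rewrite -yyH yy (involutionM starP) (involutionK starP).
by rewrite -mulrA -/y ym.
Qed.

Lemma is_weak_group_inverse_of_symmetric (starP : involution star) (d x : R)
    (n : nat) :
    is_drazin_inverse a d -> right_principal x = right_principal d ->
    star (star (a ^+ m) * a ^+ m.+1 * x) = star (a ^+ m) * a ^+ m.+1 * x ->
    a ^+ n = a * x * a ^+ n ->
  is_weak_group_inverse star m a x.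
Proof.
move=> [k [k_gt0 add_ adC dak]] xd sym axan.
have [u _ xE] : right_principal d x by rewrite -xd; exists 1; rewrite ?mulr1.
(* The idempotent [d * a] fixes d R, hence fixes [x]. *)
have dax : d * a * x = x by rewrite -xE -adC mulrA -(mulrA a) -expr2 add_.
have axaj j : (n <= j)%N -> a * x * a ^+ j = a ^+ j.
  by move=> nj; rewrite -(subnKC nj) exprD mulrA -axan.
have axd : a * x * d = d.
  by rewrite -{1}(expr_mul_exprS add_ n) mulrA -axan expr_mul_exprS.
have axx : a * x ^+ 2 = x by rewrite expr2 mulrA -{2}xE mulrA axd.
(* Large enough for both facts: a x fixes a^j from [n] on, and d a^(j+1) = a^j from [k] on. *)
pose j := (k + n)%N.
have xaj : x * a ^+ j.+1 = a ^+ j.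
  rewrite -dax -!mulrA (mulrA a) axaj ?(leq_trans (leq_addl k n)) //.
  exact: mul_exprS_le (leq_addr n k) (esym dak).
pose y := a ^+ m.+1 * x.
(* Here x a x = x, because x a^(j+1) x^(j+1) = a^j x^(j+1). *)
have yax : y * (a * x) = y.
  rewrite -{1}(expr_mul_exprS axx j) /y (mulrA a) -exprS -!mulrA (mulrA x).
  by rewrite xaj expr_mul_exprS.
have ym : star y * a ^+ m = star (a ^+ m) * y.
  by rewrite mulrA -sym -mulrA !(involutionM starP) (involutionK starP).
(* By symmetry, (a x)^* y^* a^m = (a x)^* (a^m)^* y = (a^(m+1) x)^* y. *)
have yy : star y * y = star y * a ^+ m.
  rewrite -{3}yax [in RHS](involutionM starP) -mulrA ym mulrA.
  by rewrite -(involutionM starP) mulrA -exprSr.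
have yaj : y * a ^+ j = a ^+ (j + m).
  by rewrite /y exprSr -!mulrA (mulrA a) axaj ?leq_addl // -exprD addnC.
exists (j + m)%N; split=> //; first by rewrite !addn_gt0 k_gt0.
  exact: mul_exprS_le (leq_addr m j) xaj.
by rewrite -yaj (involutionM starP) -!mulrA yy.
Qed.

End WeakGroupInverse.

Theorem theorem3p3 (R : pzRingType) (star : R -> R)
    (star_proper : proper_involution star) (m : nat) (m_gt0 : (0 < m)%N)
    (a : R) :
  (weak_group_invertible star m a <->
     drazin_invertible a /\
     exists x : R,
       [/\ right_principal x = right_principal (drazin_inverse a),
           star (star (a ^+ m) * a ^+ m.+1 * x) = star (a ^+ m) * a ^+ m.+1 * x
         & exists n : nat, (0 < n)%N /\ a ^+ n = a * x * a ^+ n]) /\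
  (drazin_invertible a ->
   forall x : R,
     [/\ right_principal x = right_principal (drazin_inverse a),
         star (star (a ^+ m) * a ^+ m.+1 * x) = star (a ^+ m) * a ^+ m.+1 * x
       & exists n : nat, (0 < n)%N /\ a ^+ n = a * x * a ^+ n] ->
     weak_group_inverse star m a = x).
Proof.
have [starP _] := star_proper.
have wgi x : drazin_invertible a ->
    [/\ right_principal x = right_principal (drazin_inverse a),
        star (star (a ^+ m) * a ^+ m.+1 * x) = star (a ^+ m) * a ^+ m.+1 * x
      & exists n : nat, (0 < n)%N /\ a ^+ n = a * x * a ^+ n] ->
    is_weak_group_inverse star m a x.
  move=> /drazin_inverseP dP [xd sym [n [_ axan]]].
  exact: (is_weak_group_inverse_of_symmetric starP dP xd sym axan).
split; last first.
  move=> aD x /(wgi x aD) xW.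
  apply: (weak_group_inverse_unique star_proper _ xW).
  (* The default value 0 is excluded because [x] is an inverse. *)
  by apply: (xgetPex 0); exists x.
split=> [[x xW]|[aD [x /(wgi x aD) xW]]]; last by exists x.
have [k [k_gt0 axx xak _]] := xW.
have aD : drazin_invertible a by eexists; exact: expr_drazin axx _ xak k_gt0.
split=> //; exists x; split.
- have [l [_ add_ _ dal]] := drazin_inverseP aD.
  exact: right_principal_eq_outer axx xak add_ (esym dal).
- exact: weak_group_inverse_symmetric.
(* The exponent [k] works as [n]: a x a^k = a x^2 a^(k+1) = x a^(k+1) = a^k. *)
- by exists k; split=> //; rewrite -{2}xak mulrA -(mulrA a) -expr2 axx xak.
Qed.
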